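(* Let $p$ be a prime. If $p$ is a Fermat prime, or $p=4q+1$ where $q>3$ is a prime, then there is no nontrivial difference set in a cyclic group of order $p$.
   Context: A Fermat prime is a prime of the form $2^k+1$ with $k\geq 1$. A subset $D$ of a finite group $G$ is a difference set if there is a nonnegative integer $\lambda$ such that every nonidentity element $g\in G$ has exactly $\lambda$ representations in the form $g=d_1^{-1}d_2$ with $d_1,d_2\in D$. A difference set $D$ in $G$ is nontrivial if $2\leq |D|\leq |G|-2$. *)

(* Defs.v *)
From HB Require Import structures.
From mathcomp Require Import all_boot all_order all_fingroup all_solvable.

Set Implicit Arguments.
Unset Strict Implicit.
Unset Printing Implicit Defensive.

Definition fermat_prime (p : nat) : Prop :=
  prime p /\ exists2 k : nat, 1 <= k & p = 2 ^ k + 1.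

Definition is_difference_set (gT : finGroupType) (G : {group gT})
    (D : {set gT}) : Prop :=
  D \subset G /\
  exists lambda : nat, forall g : gT, g \in G -> g != 1%g ->
    #|[set d : gT * gT | [&& d.1 \in D, d.2 \in D & g == (d.1^-1 * d.2)%g]]|
      = lambda.

(* The upper bound |D| <= |G| - 2 is written additively, since the subtraction
   on nat is truncated. *)
Definition nontrivial_difference_set (gT : finGroupType) (G : {group gT})
    (D : {set gT}) : Prop :=
  [/\ is_difference_set G D, 2 <= #|D| & #|D| + 2 <= #|G|].

(* Main.v *)
(* For a Fermat prime, k (k - 1) = lambda 2^m is impossible with 1 < k <= 2^m.
   Let p = 4 q + 1 and let H be the group of order q of quartic residues modulo
   p.  Up to complementation k = q or k = q + 1.  In the group ring Z[F_p] put
   A = p D - k F_p, so that A A^(-1) = 0 mod n, where n = k - lambda.  For a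
   prime power r^e dividing n, dilating by a power of r multiplies A by some
   element modulo r^e; as every t in H is a power of r unless -1 is one, this
   yields A^(t) A^(-1) = 0 mod n, and since n > lambda, t D is a translate of D.
   Hence after an affine map D = H or D = {0} + H.  Comparing the energies of
   the differences and sums of H shows that 4 b + 1 - 4 (a - b)^2 is a square,
   where a and b are the numbers of representations of 1 and of a generator as
   differences in H.  So q or q - 2 is a square: the first contradicts that q is
   prime, the second that q and 4 q + 1 are both prime, modulo 3. *)
Require Import Defs.
From HB Require Import structures.
From mathcomp Require Import all_boot all_order all_fingroup all_solvable.
From mathcomp Require Import all_algebra all_field.
From mathcomp Require Import zify ring.

Set Implicit Arguments.
Unset Strict Implicit.
Unset Printing Implicit Defensive.

Import GRing.Theory Num.Theory.

Local Open Scope ring_scope.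

(** * Divisibility by natural numbers in additive groups and rings *)

Definition ndvdr (R : zmodType) (m : nat) (x : R) := exists c, x = c *+ m.

Section NatDivisibility.

Lemma ndvdr0 (R : zmodType) m : ndvdr m (0 : R).
Proof. by exists 0; rewrite mul0rn. Qed.

Lemma ndvdr1 (R : zmodType) (x : R) : ndvdr 1 x.
Proof. by exists x. Qed.

Lemma ndvdrD (R : zmodType) m (x y : R) :
  ndvdr m x -> ndvdr m y -> ndvdr m (x + y).
Proof. by move=> [c ->] [d ->]; exists (c + d); rewrite mulrnDl. Qed.

Lemma ndvdrN (R : zmodType) m (x : R) : ndvdr m x -> ndvdr m (- x).
Proof. by move=> [c ->]; exists (- c); rewrite mulNrn. Qed.

Lemma ndvdrB (R : zmodType) m (x y : R) :
  ndvdr m x -> ndvdr m y -> ndvdr m (x - y).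
Proof. by move=> hx /ndvdrN hy; apply: ndvdrD. Qed.

Lemma ndvdr_trans (R : zmodType) m (y x z : R) :
  ndvdr m (x - y) -> ndvdr m (y - z) -> ndvdr m (x - z).
Proof. by move=> hxy /(ndvdrD hxy); rewrite addrA subrK. Qed.

Lemma ndvdr_sym (R : zmodType) m (x y : R) : ndvdr m (x - y) -> ndvdr m (y - x).
Proof. by move/ndvdrN; rewrite opprB. Qed.

Lemma ndvdr_sum (R : zmodType) (I : Type) (s : seq I) (P : pred I) m
    (f : I -> R) :
  (forall i, P i -> ndvdr m (f i)) -> ndvdr m (\sum_(i <- s | P i) f i).
Proof.
by move=> h; apply: big_ind => //; [exact: ndvdr0 | exact: ndvdrD].
Qed.

Lemma ndvdr_weaken (R : zmodType) m n (x : R) :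
  (m %| n)%N -> ndvdr n x -> ndvdr m x.
Proof. by move=> /dvdnP[k ->] [c ->]; exists (c *+ k); rewrite mulrnA. Qed.

(** Bezout: with k n = l m + 1, x equals k (n x) - l (m x), and both terms are multiples of m. *)
Lemma ndvdr_coprime (R : zmodType) m n (x : R) : (0 < n)%N ->
  coprime m n -> ndvdr m (x *+ n) -> ndvdr m x.
Proof.
move=> n0 mn [c hc]; have [k l e _] := egcdnP m n0.
move: mn e; rewrite coprime_sym /coprime => /eqP -> e.
exists (c *+ k - x *+ l); rewrite mulrnBl -mulrnAC -hc -!mulrnA mulnC e.
by rewrite mulrnDr mulr1n addrC addKr.
Qed.

Lemma ndvdr_mul_coprime (R : zmodType) m n (x : R) : (0 < n)%N ->
  coprime m n -> ndvdr m x -> ndvdr n x -> ndvdr (m * n) x.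
Proof.
move=> n0 mn hm [c hc]; move: hm; rewrite hc => /(ndvdr_coprime n0 mn) [d ->].
by exists d; rewrite mulrnA.
Qed.

(** Strong induction on n, splitting off the full power of its least prime factor. This allows the
    congruences modulo n to be proved one prime power at a time. *)
Lemma ndvdr_primes (R : zmodType) n (x : R) : (0 < n)%N ->
  (forall r, prime r -> ndvdr (r ^ logn r n) x) -> ndvdr n x.
Proof.
have [b] := ubnP n; elim: b n => // b IH n nb n0 h.
have [n1|n1] := leqP n 1.
  have -> : n = 1%N by apply/eqP; rewrite eqn_leq n1.
  exact: ndvdr1.
have pr := pdiv_prime n1; set p := pdiv n in pr *.
have [m pm e] := pfactor_coprime pr n0.
have m0 : (0 < m)%N by move: n0; rewrite e; case: (m).
have pe0 : (0 < p ^ logn p n)%N by rewrite expn_gt0 prime_gt0.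
rewrite e; apply: ndvdr_mul_coprime => //.
- by rewrite coprime_sym coprimeXl.
- apply: IH => //; last first.
    move=> r rp; have [->|rnp] := eqVneq r p.
      rewrite lognE (negbTE (_ : ~~ (p %| m)%N)) ?andbF //; first exact: ndvdr1.
      by rewrite -prime_coprime.
    have -> : logn r m = logn r n; last exact: h.
    by rewrite [in RHS]e lognM // lognX (logn_prime _ pr) (negbTE rnp) muln0 addn0.
  apply: leq_trans (_ : n <= b)%N => //; rewrite [X in (_ < X)%N]e ltn_Pmulr //.
  rewrite -[X in (X < _)%N](expn0 p) ltn_exp2l ?prime_gt1 //.
  by rewrite logn_gt0 mem_primes pr n0 pdiv_dvd.
- exact: h.
Qed.

Variable R : comPzRingType.

Lemma ndvdrMr m (x y : R) : ndvdr m x -> ndvdr m (x * y).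
Proof. by move=> [c ->]; exists (c * y); rewrite mulrnAl. Qed.

Lemma ndvdrMl m (x y : R) : ndvdr m x -> ndvdr m (y * x).
Proof. by rewrite mulrC; apply: ndvdrMr. Qed.

Lemma ndvdrM m n (x y : R) : ndvdr m x -> ndvdr n y -> ndvdr (m * n) (x * y).
Proof.
by move=> [c ->] [d ->]; exists (c * d); rewrite mulrnAl mulrnAr mulnC mulrnA.
Qed.

Lemma ndvdr_exprB m (x y : R) i : ndvdr m (x - y) -> ndvdr m (x ^+ i - y ^+ i).
Proof. by move=> h; rewrite subrXX; apply: ndvdrMr. Qed.

(** In the factorization of x^r - y^r by x - y, the cofactor is congruent to r x^(r-1) modulo r,
    because x and y agree modulo r. The cofactor thus contributes one more factor r. *)
Lemma ndvdr_exprB_lift r m (x y : R) : (r %| m)%N ->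
  ndvdr m (x - y) -> ndvdr (r * m) (x ^+ r - y ^+ r).
Proof.
move=> rm h; rewrite subrXX mulnC; apply: ndvdrM => //.
have hr : ndvdr r (x - y) by apply: ndvdr_weaken h.
have -> : \sum_(i < r) x ^+ (r.-1 - i) * y ^+ i
   = \sum_(i < r) x ^+ (r.-1 - i) * (y ^+ i - x ^+ i) + x ^+ r.-1 *+ r.
  have -> : x ^+ r.-1 *+ r = \sum_(i < r) x ^+ r.-1 by rewrite sumr_const card_ord.
  rewrite -big_split /=.
  apply: eq_bigr => i _; rewrite mulrBr -exprD subnK ?subrK //.
  by have := ltn_ord i; lia.
apply: ndvdrD; last by exists (x ^+ r.-1).
by apply: ndvdr_sum => i _; apply/ndvdrMl/ndvdr_exprB/ndvdr_sym.
Qed.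

Lemma ndvdr_exprXB r j (x y : R) :
  ndvdr r (x - y) -> ndvdr (r ^ j.+1) (x ^+ (r ^ j) - y ^+ (r ^ j)).
Proof.
move=> h; elim: j => [|j IH]; first by rewrite expn1.
rewrite expnS [(r ^ j.+1)%N in X in ndvdr _ X]expnSr !exprM.
by apply: ndvdr_exprB_lift => //; rewrite expnS dvdn_mulr.
Qed.

Lemma ndvdr_exprDn r (x y : R) : prime r ->
  ndvdr r ((x + y) ^+ r - (x ^+ r + y ^+ r)).
Proof.
case: r => [|r] // pr; rewrite exprDn big_ord_recr big_ord_recl /=.
rewrite bin0 binn !mulr1n subnn subn0 !expr0 mulr1 mul1r.
rewrite addrAC [X in ndvdr _ (X - _)]addrC addrK.
apply: ndvdr_sum => i _; exists (x ^+ (r.+1 - bump 0 i) * y ^+ bump 0 i *+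
   ('C(r.+1, bump 0 i) %/ r.+1)).
rewrite -mulrnA divnK // prime_dvd_bin //.
by rewrite /bump /= add1n ltnS /= ltn_ord.
Qed.

End NatDivisibility.

(** * Lifts of the Frobenius map having finite order *)

Section FrobeniusLift.

Variables (R : comPzRingType) (r d : nat) (phi : {rmorphism R -> R}).
Hypotheses (d_gt0 : (0 < d)%N) (phi_iter : forall x, iter d phi x = x).
Hypothesis phi_frob : forall x, ndvdr r (phi x - x ^+ r).

Lemma iter_frob j (x : R) : ndvdr r (iter j phi x - x ^+ (r ^ j)).
Proof.
elim: j => [|j IH]; first by rewrite subrr; apply: ndvdr0.
rewrite iterS expnSr exprM; apply: (ndvdr_trans (phi_frob _)).
exact: ndvdr_exprB.
Qed.

(** As [phi] iterated d times is the identity and [phi] is the r-th power map modulo r, raising to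
    the power r^d is the identity modulo r. In particular R / r has no nilpotents. *)
Lemma frob_fixed j (x : R) : ndvdr r (x - x ^+ (r ^ (d * j))).
Proof.
suff e : iter (d * j) phi x = x by rewrite -{1}e; apply: iter_frob.
by elim: j => [|j IH]; rewrite ?muln0 // mulnS iterD IH phi_iter.
Qed.

Lemma ndvdr_morph m (x : R) : ndvdr m x -> ndvdr m (phi x).
Proof. by move=> [c ->]; exists (phi c); rewrite rmorphMn. Qed.

Hypothesis r_prime : prime r.

(* Induction on [e]: with [N] a power of [r] such that [x = x ^+ N + b *+ r],
   the summand [phi x ^+ N] is [x ^+ (r * N)] modulo [r ^ e], and the induction
   hypothesis applies to [b]. *)
Lemma frob_multiple e (x : R) : exists w, ndvdr (r ^ e) (phi x - x * w).
Proof.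
have r0 := prime_gt0 r_prime.
elim: e x => [|e IH] x; first by exists 0; apply: ndvdr1.
pose N := (r ^ (d * e))%N; have N0 : (0 < N)%N by rewrite expn_gt0 r0.
have [b hb] : ndvdr r (x - x ^+ N) by apply: frob_fixed.
have [w hw] := IH b.
exists (x ^+ (r * N).-1 + (1 - x ^+ N.-1) * w).
have -> : phi x - x * (x ^+ (r * N).-1 + (1 - x ^+ N.-1) * w)
    = (phi x ^+ N - (x ^+ r) ^+ N) + (phi b - b * w) *+ r.
  have e1 : x * x ^+ (r * N).-1 = (x ^+ r) ^+ N.
    by rewrite -exprS -exprM prednK // muln_gt0 r0.
  have e2 : x * x ^+ N.-1 = x ^+ N by rewrite -exprS prednK.
  have e3 : phi x - phi x ^+ N = phi b *+ r by rewrite -rmorphXn -rmorphB hb rmorphMn.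
  rewrite mulrnBl -e3 -mulrnAl -hb mulrDr e1 mulrA mulrBr mulr1 e2.
  ring.
apply: ndvdrD.
  apply: ndvdr_weaken (ndvdr_exprXB _ (phi_frob x)).
  by rewrite dvdn_exp2l // ltnS leq_pmull.
by case: hw => c ->; exists c; rewrite -mulrnA expnSr.
Qed.

Lemma iter_frob_multiple e i (x : R) : exists w, ndvdr (r ^ e) (iter i phi x - x * w).
Proof.
elim: i => [|i [w hw]].
  by exists 1; rewrite mulr1 subrr; apply: ndvdr0.
have [v hv] := frob_multiple e x.
exists (v * phi w); rewrite mulrA.
have /ndvdr_morph := hw; rewrite rmorphB rmorphM => /ndvdr_trans; apply.
by rewrite -mulrBl; apply: ndvdrMr.
Qed.

Hypothesis torsion_free : forall (x : R) m, (0 < m)%N -> x *+ m = 0 -> x = 0.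

(** Modulo r, x equals x^(r^d), a multiple of x * x since r^d >= 2, so x = r b. Torsion-freeness
    lets r^2 be cancelled, and the induction continues with b and e - 2. *)
Lemma ndvdr_sqr e (x : R) : ndvdr (r ^ e) (x * x) ->
  exists f, (e <= f + f)%N /\ ndvdr (r ^ f) x.
Proof.
have [n] := ubnP e; elim: n e x => // n IH [|e] x en h.
  by exists 0%N; split => //; apply: ndvdr1.
have [b hb] : ndvdr r x.
  have rx : ndvdr r (x * x).
    by apply: ndvdr_weaken h; rewrite expnS dvdn_mulr.
  have := frob_fixed 1 x; rewrite muln1 => hx.
  rewrite -(subrK (x ^+ (r ^ d)) x); apply: ndvdrD => //.
  have -> : (r ^ d = (r ^ d - 2) + 2)%N.
    rewrite subnK // (leq_trans (prime_gt1 r_prime)) //.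
    by rewrite -[X in (X <= _)%N]expn1 leq_exp2l // prime_gt1.
  by rewrite exprD; apply: ndvdrMl.
case: e en h => [|e] en h; first by exists 1%N; split => //; exists b.
have [] := IH e b; first by move: en; rewrite !ltnS; apply: leq_trans.
  case: h => c hc; exists c.
  apply/eqP; rewrite -subr_eq0; apply/eqP.
  apply: (torsion_free (m := (r * r)%N)); first by rewrite muln_gt0 prime_gt0.
  rewrite mulrnBl -[c *+ _ *+ _]mulrnA [(r ^ e * _)%N]mulnA -!expnSr -hc hb.
  by rewrite mulrnAl mulrnAr -mulrnA subrr.
move=> f [ef [c hc]]; exists f.+1; split; first by rewrite addSn addnS !ltnS.
by exists c; rewrite hb hc -mulrnA expnSr.
Qed.

End FrobeniusLift.

(** * The integral group ring of a finite abelian group *)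

Definition group_ring (V : finZmodType) : Type := {ffun V -> int}.

(** Only the additive structure is taken over from functions, as the product is to be
    convolution. *)
HB.instance Definition _ (V : finZmodType) :=
  GRing.Zmodule.copy (group_ring V) {ffun V -> int}.

Section GroupRing.

Variable V : finZmodType.
Implicit Types (x y z : group_ring V) (D E : {set V}).

Definition gr_fun (x : group_ring V) : V -> int := (x : {ffun V -> int}).

Definition gr_point (u : V) : group_ring V := [ffun v => (v == u)%:R].

Definition gr_mul x y : group_ring V :=
  [ffun v => \sum_u gr_fun x u * gr_fun y (v - u)].

Lemma gr_eqP x y : (forall v, gr_fun x v = gr_fun y v) -> x = y.
Proof. by move=> h; apply/ffunP. Qed.

Lemma gr_funD x y v : gr_fun (x + y) v = gr_fun x v + gr_fun y v.
Proof. by rewrite /gr_fun !ffunE. Qed.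

Lemma gr_funN x v : gr_fun (- x) v = - gr_fun x v.
Proof. by rewrite /gr_fun !ffunE. Qed.

Lemma gr_funMn x m v : gr_fun (x *+ m) v = gr_fun x v *+ m.
Proof.
elim: m => [|m IH]; first by rewrite !mulr0n /gr_fun ffunE.
by rewrite !mulrS gr_funD IH.
Qed.

Lemma gr_pointE u v : gr_fun (gr_point u) v = (v == u)%:R.
Proof. by rewrite /gr_fun ffunE. Qed.

Lemma gr_mulE x y v :
  gr_fun (gr_mul x y) v = \sum_u gr_fun x u * gr_fun y (v - u).
Proof. by rewrite /gr_fun /gr_mul ffunE. Qed.

Lemma gr_mulC : commutative gr_mul.
Proof.
move=> x y; apply: gr_eqP => v; rewrite !gr_mulE.
rewrite (reindex_inj (can_inj (subKr v))) /=.
by apply: eq_bigr => u _; rewrite subKr mulrC.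
Qed.

Lemma gr_mulA : associative gr_mul.
Proof.
move=> x y z; apply: gr_eqP => v; rewrite !gr_mulE.
under eq_bigr => u _ do rewrite gr_mulE mulr_sumr.
under [RHS]eq_bigr => t _ do rewrite gr_mulE mulr_suml.
rewrite [RHS]exchange_big /=; apply: eq_bigr => u _.
rewrite [RHS](reindex_inj (addIr u)) /=; apply: eq_bigr => w _.
by rewrite mulrA addrK opprD addrCA addrC -addrA [- u + _]addrC addrA.
Qed.

Lemma gr_mul1 : left_id (gr_point 0) gr_mul.
Proof.
move=> x; apply: gr_eqP => v; rewrite gr_mulE (bigD1 0) //= big1 => [|u u0].
  by rewrite gr_pointE eqxx mul1r addr0 subr0.
by rewrite gr_pointE (negbTE u0) mul0r.
Qed.

Lemma gr_mulDl : left_distributive gr_mul +%R.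
Proof.
move=> x y z; apply: gr_eqP => v; rewrite gr_funD !gr_mulE -big_split /=.
by apply: eq_bigr => u _; rewrite gr_funD mulrDl.
Qed.

HB.instance Definition _ := GRing.Zmodule_isComPzRing.Build (group_ring V)
  gr_mulA gr_mulC gr_mul1 gr_mulDl.

Lemma gr_funM x y v :
  gr_fun (x * y) v = \sum_u gr_fun x u * gr_fun y (v - u).
Proof. exact: gr_mulE. Qed.

Lemma gr_pointD u v : gr_point (u + v) = gr_point u * gr_point v.
Proof.
apply: gr_eqP => w; rewrite gr_funM (bigD1 u) //= big1 => [|t tu].
  by rewrite !gr_pointE eqxx mul1r addr0 subr_eq addrC.
by rewrite gr_pointE (negbTE tu) mul0r.
Qed.

Lemma gr_pointMn u m : gr_point (u *+ m) = gr_point u ^+ m.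
Proof. by elim: m => // m IH; rewrite mulrS gr_pointD IH exprS. Qed.

Lemma gr_torsion_free x m : (0 < m)%N -> x *+ m = 0 -> x = 0.
Proof.
move=> m0 h; apply: gr_eqP => v; rewrite [RHS]ffunE.
have : gr_fun (x *+ m) v = 0 by rewrite h [LHS]ffunE.
by rewrite gr_funMn -mulr_natr => /eqP; rewrite mulf_eq0; lia.
Qed.

Lemma gr_sum_fun (I : Type) (s : seq I) (P : pred I) (f : I -> group_ring V) v :
  gr_fun (\sum_(i <- s | P i) f i) v = \sum_(i <- s | P i) gr_fun (f i) v.
Proof.
apply: (big_morph (fun x => gr_fun x v)) => [x y|]; first exact: gr_funD.
by rewrite [LHS]ffunE.
Qed.

(** The point masses generate the additive group. This induction reduces the Frobenius congruence
    for dilations to [gr_point]. *)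
Lemma gr_ind (P : group_ring V -> Prop) : P 0 ->
  (forall x y, P x -> P y -> P (x + y)) -> (forall x, P x -> P (- x)) ->
  (forall u, P (gr_point u)) -> forall x, P x.
Proof.
move=> P0 PD PN Pp x.
have Pn u m : P (gr_point u *+ m).
  by elim: m => // m IH; rewrite mulrS; apply: PD.
have -> : x = \sum_u gr_point u *~ gr_fun x u.
  apply: gr_eqP => v; rewrite gr_sum_fun (bigD1 v) //= big1 => [|u uv].
    rewrite addr0; case: (gr_fun x v) => m; rewrite ?NegzE ?mulrNz ?gr_funN.
      by rewrite gr_funMn gr_pointE eqxx /=; lia.
    by rewrite gr_funMn gr_pointE eqxx; lia.
  case: (gr_fun x u) => m; rewrite ?NegzE ?mulrNz ?gr_funN gr_funMn gr_pointE.
    by rewrite eq_sym (negbTE uv) mul0rn.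
  by rewrite eq_sym (negbTE uv) mul0rn oppr0.
apply: big_ind => // u _; case: (gr_fun x u) => m; first exact: Pn.
by rewrite NegzE mulrNz; apply/PN/Pn.
Qed.

Definition gr_set D : group_ring V := [ffun v => (v \in D)%:R].

Lemma gr_setE D v : gr_fun (gr_set D) v = (v \in D)%:R.
Proof. by rewrite /gr_fun ffunE. Qed.

Lemma gr_setM D E v :
  gr_fun (gr_set D * gr_set E) v = #|[set d in D | v - d \in E]|%:R.
Proof.
rewrite gr_funM -sum1_card natr_sum [RHS]big_mkcond /=; apply: eq_bigr => u _.
by rewrite !gr_setE inE; case: (u \in D) (v - u \in E) => [] [].
Qed.

Lemma gr_setMT D : gr_set D * gr_set setT = gr_set setT *+ #|D|.
Proof.
apply: gr_eqP => v; rewrite gr_setM gr_funMn gr_setE in_setT.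
by congr (_%:R); apply: eq_card => u; rewrite !inE andbT.
Qed.

Lemma sum_gr_setM D E :
  \sum_v gr_fun (gr_set D * gr_set E) v = (#|D| * #|E|)%:R.
Proof.
under eq_bigr => v _ do rewrite gr_funM.
rewrite exchange_big /= natrM.
have sE u : \sum_v gr_fun (gr_set E) (v - u) = #|E|%:R.
  rewrite (reindex_inj (addIr u)) -sum1_card natr_sum [RHS]big_mkcond /=.
  by apply: eq_bigr => v _; rewrite addrK gr_setE; case: (v \in E).
under eq_bigr => u _ do rewrite -mulr_sumr sE.
rewrite -mulr_suml; congr (_ * _).
rewrite -sum1_card natr_sum [RHS]big_mkcond /=.
by apply: eq_bigr => v _; rewrite gr_setE; case: (v \in D).
Qed.

End GroupRing.

(** * Dilations of the group ring of a finite field *)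

Lemma expf_card_pred (F : finFieldType) (x : F) : x != 0 -> x ^+ #|F|.-1 = 1.
Proof.
move=> x0; apply: (mulfI x0); rewrite -exprS prednK ?expf_card ?mulr1 //.
by apply/card_gt0P; exists x.
Qed.

Section Dilation.

Variable F : finFieldType.
Implicit Types (x y : group_ring F) (D : {set F}) (t : F).

Definition dilate t x : group_ring F := [ffun v => gr_fun x (t^-1 * v)].

Lemma dilateE t x v : gr_fun (dilate t x) v = gr_fun x (t^-1 * v).
Proof. by rewrite /gr_fun ffunE. Qed.

Lemma dilate_dilate s t x : dilate s (dilate t x) = dilate (s * t) x.
Proof. by apply: gr_eqP => v; rewrite !dilateE invfM mulrCA mulrA. Qed.

Lemma dilate1 x : dilate 1 x = x.
Proof. by apply: gr_eqP => v; rewrite dilateE invr1 mul1r. Qed.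

Lemma dilate_set t D : t != 0 ->
  dilate t (gr_set D) = gr_set [set t * d | d in D].
Proof.
move=> t0; apply: gr_eqP => v; rewrite dilateE !gr_setE; congr (nat_of_bool _)%:R.
apply/idP/imsetP => [h|[d dD ->]]; last by rewrite mulKf.
by exists (t^-1 * v); rewrite ?mulVKf.
Qed.

Lemma dilate_point t u : t != 0 -> dilate t (gr_point u) = gr_point (t * u).
Proof.
move=> t0; apply: gr_eqP => v; rewrite dilateE !gr_pointE; congr (nat_of_bool _)%:R.
by rewrite -(inj_eq (mulfI t0)) mulVKf.
Qed.

(** Carrying the proof of [t != 0] in the term lets a ring morphism structure be attached to it. *)
Definition dilation t (t0 : t != 0) := dilate t.

Section Morphism.

Variables (t : F) (t0 : t != 0).

Lemma dilate_is_zmod : zmod_morphism (dilation t0).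
Proof.
by move=> x y; apply: gr_eqP => v; rewrite !(dilateE, gr_funD, gr_funN).
Qed.

Lemma dilate_is_monoid : monoid_morphism (dilation t0).
Proof.
split=> [|x y]; first by rewrite [LHS]dilate_point // mulr0.
apply: gr_eqP => v; rewrite dilateE !gr_funM.
rewrite [RHS](reindex_inj (mulfI t0)) /=; apply: eq_bigr => u _.
by rewrite !dilateE mulKf // mulrBr mulKf.
Qed.

HB.instance Definition _ := GRing.isZmodMorphism.Build _ _ (dilation t0)
  dilate_is_zmod.
HB.instance Definition _ := GRing.isMonoidMorphism.Build _ _ (dilation t0)
  dilate_is_monoid.

Lemma iter_dilation i x : iter i (dilation t0) x = dilate (t ^+ i) x.
Proof.
elim: i => [|i IH]; first by rewrite dilate1.
by rewrite iterS IH [LHS]dilate_dilate exprS.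
Qed.

Lemma iter_dilation_card x : iter #|F|.-1 (dilation t0) x = x.
Proof.
by rewrite iter_dilation expf_card_pred // dilate1.
Qed.

End Morphism.

(** Both maps are additive modulo r, and they agree exactly on a point mass, since the r-th power of
    [gr_point u] is the point mass at r u. *)
Lemma dilation_frob r (r0 : r%:R != 0 :> F) x : prime r ->
  ndvdr r (dilation r0 x - x ^+ r).
Proof.
move=> pr; have rgt := prime_gt0 pr.
have PD y z : ndvdr r (dilation r0 y - y ^+ r) ->
    ndvdr r (dilation r0 z - z ^+ r) ->
    ndvdr r (dilation r0 (y + z) - (y + z) ^+ r).
  move=> hy hz; apply: (@ndvdr_trans _ _ (y ^+ r + z ^+ r)).
    by rewrite rmorphD opprD addrACA; apply: ndvdrD.
  by apply/ndvdr_sym/ndvdr_exprDn.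
move: x; apply: gr_ind => //.
- by rewrite rmorph0 expr0n; case: (r) rgt => // m _; rewrite subrr; apply: ndvdr0.
- move=> y hy; apply: ndvdr_sym; rewrite rmorphN opprK.
  (* Additivity of the r-th power modulo r, applied to y and -y, gives the sign rule for every
     prime, including r = 2. *)
  have := ndvdr_exprDn y (- y) pr; rewrite subrr expr0n eqn0Ngt rgt sub0r.
  move/ndvdrN; rewrite opprK => /ndvdrD/(_ hy).
  by rewrite [X in ndvdr _ X]addrC addrA subrK addrC.
- move=> u; rewrite -gr_pointMn [dilation _ _]dilate_point // mulr_natl subrr.
  exact: ndvdr0.
Qed.

Lemma neg1_neq0 : -1 != 0 :> F.
Proof. by rewrite oppr_eq0 oner_eq0. Qed.

(** The standard involution of the group ring, written with exponent -1 in D D^(-1). *)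
Definition gr_bar := dilation neg1_neq0.

Lemma gr_mul_bar_set D (E : {set F}) v :
  gr_fun (gr_set E * gr_bar (gr_set D)) v = #|[set d in E | d - v \in D]|%:R.
Proof.
rewrite [gr_bar _]dilate_set ?neg1_neq0 // gr_setM; congr (_%:R).
apply: eq_card => d; rewrite !inE; congr (_ && _).
apply/imsetP/idP => [[c cD e]|h]; last by exists (d - v); rewrite // mulN1r opprB.
by rewrite -opprB e mulN1r opprK.
Qed.

End Dilation.

(** * Multipliers of difference sets modulo p = 4 q + 1 *)

Definition diff_count (V : finZmodType) (D : {set V}) (v : V) : nat :=
  #|[set d in D | d + v \in D]|.

Lemma prime_primitive_root (F : fieldType) (q : nat) (s : F) :
  prime q -> s ^+ q = 1 -> s != 1 -> q.-primitive_root s.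
Proof.
move=> pq sq s1; have [m pm] := prim_order_exists (prime_gt0 pq) sq.
case/primeP: pq => _ /[apply] /orP[] /eqP e; last by rewrite -e.
by case/eqP: s1; rewrite -(prim_expr_order pm) e expr1.
Qed.

Lemma expr4_subr1 (R : comPzRingType) (r : R) :
  (r ^+ 2 + 1) * (r + 1) * (r - 1) = r ^+ 4 - 1.
Proof. by ring. Qed.

(** With J the sum of all group elements, [X *+ p - J *+ k] annihilates J. Expanding leaves X Y p^2
    - J p k^2, and k^2 = n + lam p then separates the part divisible by n. *)
Lemma centered_product (R : comPzRingType) (X Y J : R) (p k n lam : nat) :
  X * J = J *+ k -> Y * J = J *+ k -> J * J = J *+ p ->
  (k * k = n + lam * p)%N ->
  (X *+ p - J *+ k) * (Y *+ p - J *+ k)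
  = (X * Y - J *+ lam) *+ (p * p) - J *+ (p * n).
Proof.
move=> XJ YJ JJ /(congr1 (fun m => m%:R : R)); move: XJ YJ JJ.
rewrite -(mulr_natr J k) -(mulr_natr J p) -(mulr_natr X) -(mulr_natr Y).
rewrite -(mulr_natr J lam) -(mulr_natr J) -(mulr_natr _ (p * p)) natrD !natrM.
move: (p%:R) (k%:R) (n%:R) (lam%:R) => P K N L XJ YJ JJ KK.
transitivity (X * Y * P * P - X * J * K * P - Y * J * K * P + J * J * K * K).
  by ring.
rewrite XJ YJ JJ; transitivity (X * Y * P * P - J * P * (K * K)); first by ring.
by rewrite KK; ring.
Qed.

Section Multiplier.

Variables (p q : nat).
Hypotheses (p_prime : prime p) (q_prime : prime q) (pE : p = (4 * q).+1).

Local Notation F := 'F_p.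

Lemma Fp_exp_pred (x : F) : x != 0 -> x ^+ (4 * q) = 1.
Proof.
have -> : (4 * q = #|F|.-1)%N by rewrite card_Fp // pE.
exact: expf_card_pred.
Qed.

Lemma natr_Fp_eq0 m : (m%:R == 0 :> F) = (p %| m)%N.
Proof. by rewrite (dvdn_pcharf (pchar_Fp p_prime)). Qed.

(** The order of r^4 divides the prime q. If r^4 = 1 then r, not being 1, is -1 or a square root of
    -1; otherwise r^4 generates all solutions of t^q = 1. *)
Lemma power_dichotomy (r t : F) : r != 0 -> r != 1 -> t ^+ q = 1 ->
  (exists i, t = r ^+ i) \/ (exists i, -1 = r ^+ i).
Proof.
move=> r0 r1 tq; have [r4|r4] := eqVneq (r ^+ 4) 1.
  right; have : (r ^+ 2 + 1) * (r + 1) * (r - 1) = 0.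
    by rewrite expr4_subr1 r4 subrr.
  move/eqP; rewrite !mulf_eq0 subr_eq0 (negbTE r1) orbF !addr_eq0.
  by case/orP => /eqP e; [exists 2%N | exists 1%N].
left; have /prim_rootP/(_ _ tq)[i ->] : q.-primitive_root (r ^+ 4).
  by apply: prime_primitive_root => //; rewrite -exprM Fp_exp_pred.
by exists (4 * i)%N; rewrite exprM.
Qed.

Variables (D : {set F}) (lam : nat).
Hypothesis D_diff : forall v, v != 0 -> diff_count D v = lam.
Hypothesis D_card : (lam + lam < #|D| < p)%N.

Let k := #|D|.
Let n := (k - lam)%N.
Let all_one : group_ring F := gr_set setT.
Let A : group_ring F := gr_set D *+ p - all_one *+ k.

Local Notation bar := (@gr_bar F).

Lemma diff_count0 : diff_count D 0 = k.
Proof. by apply: eq_card => d; rewrite !inE addr0 andbb. Qed.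

Lemma set_mul_bar : gr_set D * bar (gr_set D) = 1 *+ n + all_one *+ lam.
Proof.
apply: gr_eqP => v; rewrite gr_mul_bar_set gr_funD !gr_funMn gr_setE in_setT.
rewrite [gr_fun 1 v]gr_pointE -/(diff_count D (- v)).
have [->|v0] := eqVneq v 0.
  rewrite oppr0 diff_count0 -mulrnDr /n subnK //.
  by case/andP: D_card => h _; rewrite ltnW // (leq_ltn_trans (leq_addr _ _) h).
by rewrite D_diff ?oppr_eq0 // mul0rn add0r.
Qed.

(** Obtained by summing all coefficients on both sides of [set_mul_bar]. *)
Lemma card_sqr : (k * k = n + lam * p)%N.
Proof.
have := sum_gr_setM D [set -1 * d | d in D].
rewrite -(dilate_set D (neg1_neq0 F)) -/(dilation (neg1_neq0 F)) -/(gr_bar _) set_mul_bar.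
rewrite card_imset; last by apply: mulfI; rewrite neg1_neq0.
under eq_bigr => v _ do rewrite gr_funD !gr_funMn gr_setE in_setT [gr_fun 1 v]gr_pointE.
rewrite big_split /= sumr_const card_Fp // (bigD1 0) //= big1 => [|v v0].
  by rewrite ?eqxx addr0 -!mulrnA mul1n -mulrnDr => /eqP; rewrite eqr_nat mul1n => /eqP ->.
by rewrite (negbTE v0) mul0rn.
Qed.

Lemma dilate_all_one t (t0 : t != 0) : dilation t0 all_one = all_one.
Proof.
by apply: gr_eqP => v; rewrite dilateE !gr_setE !in_setT.
Qed.

Lemma all_one_sqr : all_one * all_one = all_one *+ p.
Proof. by rewrite [LHS]gr_setMT cardsT card_Fp. Qed.

Lemma dilate_centered t (t0 : t != 0) :
  dilation t0 A * bar A =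
  (dilation t0 (gr_set D) * bar (gr_set D) - all_one *+ lam) *+ (p * p)
  - all_one *+ (p * n).
Proof.
have hD : bar (gr_set D) * all_one = all_one *+ k.
  rewrite [bar _]dilate_set ?neg1_neq0 // gr_setMT card_imset //.
  by apply: mulfI; rewrite neg1_neq0.
have ht : dilation t0 (gr_set D) * all_one = all_one *+ k.
  by rewrite [dilation _ _]dilate_set // gr_setMT card_imset //; apply: mulfI.
have -> : dilation t0 A = dilation t0 (gr_set D) *+ p - all_one *+ k.
  by rewrite rmorphB !rmorphMn /= dilate_all_one.
have -> : bar A = bar (gr_set D) *+ p - all_one *+ k.
  by rewrite /gr_bar rmorphB !rmorphMn /= dilate_all_one.
exact: centered_product all_one_sqr card_sqr.
Qed.

Lemma centered_norm : ndvdr n (A * bar A).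
Proof.
have -> : A * bar A = dilation (oner_neq0 F) A * bar A.
  by rewrite [dilation _ A]dilate1.
rewrite dilate_centered [dilation _ _]dilate1 set_mul_bar addrK.
apply: ndvdrB; first by exists (1 *+ (p * p)); rewrite -!mulrnA mulnC.
by exists (all_one *+ p); rewrite mulrnA.
Qed.

Lemma bar_bar x : bar (bar x) = x.
Proof. by rewrite [bar _]dilate_dilate mulrNN mulr1 dilate1. Qed.

Lemma iter_bar (r : F) i (x : group_ring F) (r0 : r != 0) :
  -1 = r ^+ i -> iter i (dilation r0) x = bar x.
Proof. by move=> e; rewrite iter_dilation /gr_bar /dilation e. Qed.

(* If [-1] is a power of [r] then [bar A] is a multiple of [A] modulo [r ^ e],
   hence [A * A = 0] there, and [A] is divisible by [r] to half the power. *)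
Lemma dilated_norm t (t0 : t != 0) : t ^+ q = 1 ->
  ndvdr n (dilation t0 A * bar A).
Proof.
move=> tq; have n0 : (0 < n)%N.
  by case/andP: D_card => h _; rewrite subn_gt0 (leq_ltn_trans (leq_addr _ _) h).
apply: ndvdr_primes => // r pr; set e := logn r n.
have rn : ndvdr (r ^ e) (A * bar A).
  by apply: ndvdr_weaken centered_norm; rewrite pfactor_dvdnn.
have [rdn|rdn] := boolP (r %| n)%N; last first.
  by rewrite /e lognE (negbTE rdn) !andbF; apply: ndvdr1.
have rp : (r < p)%N.
  apply: leq_ltn_trans (dvdn_leq n0 rdn) _.
  by case/andP: D_card => _; apply: leq_ltn_trans; rewrite leq_subr.
have r0 : r%:R != 0 :> F.
  by rewrite natr_Fp_eq0 gtnNdvd // prime_gt0.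
have r1 : r%:R != 1 :> F.
  have r1 := prime_gt1 pr.
  rewrite -subr_eq0 -(natrB _ (ltnW r1)) natr_Fp_eq0 gtnNdvd ?subn_gt0 //.
  by apply: leq_ltn_trans rp; rewrite leq_subr.
have card0 : (0 < #|F|.-1)%N by rewrite card_Fp // -subn1 subn_gt0 prime_gt1.
have frob := iter_frob_multiple card0 (iter_dilation_card r0)
  (fun x => dilation_frob r0 x pr) pr e.
have [[i ti]|[i ri]] := power_dichotomy r0 r1 tq.
  have [w hw] := frob i A.
  have -> : dilation t0 A = iter i (dilation r0) A.
    by rewrite iter_dilation /dilation ti.
  rewrite -(subrK (A * w) (iter _ _ _)) mulrDl; apply: ndvdrD.
    exact: ndvdrMr.
  by rewrite mulrAC; apply: ndvdrMr.
have [w hw] := frob i A; rewrite iter_bar // in hw.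
have AA : ndvdr (r ^ e) (A * A).
  have hw' : ndvdr (r ^ e) (A - bar A * bar w).
    by have := ndvdr_morph bar hw; rewrite rmorphB rmorphM /= -/(gr_bar _) !bar_bar.
  rewrite -{2}(subrK (bar A * bar w) A) mulrDr; apply: ndvdrD.
    exact: ndvdrMl.
  by rewrite mulrA; apply: ndvdrMr.
have [f [ef hf]] := ndvdr_sqr card0 (iter_dilation_card r0)
  (fun x => dilation_frob r0 x pr) pr (@gr_torsion_free _) AA.
apply: (@ndvdr_weaken _ _ (r ^ f * r ^ f)); first by rewrite -expnD dvdn_exp2l.
by apply: ndvdrM; apply: ndvdr_morph.
Qed.

(** Every overlap of t D with D + v has size congruent to lam modulo n, and these sizes sum to k^2 =
    n + lam p, so one of them exceeds lam. It is then at least lam + n = k, which forces t D = D +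
    v. *)
Lemma multiplier t : t != 0 -> t ^+ q = 1 ->
  exists s, forall d, d \in D -> t * d - s \in D.
Proof.
move=> t0 /(dilated_norm t0); rewrite dilate_centered => h.
(* The factor p^2 is cancelled, being coprime to n because 0 < n < p. *)
have /ndvdr_coprime : ndvdr n
    ((dilation t0 (gr_set D) * bar (gr_set D) - all_one *+ lam) *+ (p * p)).
  rewrite -(subrK (all_one *+ (p * n)) (_ *+ (p * p))); apply: ndvdrD => //.
  by exists (all_one *+ p); rewrite mulrnA.
have [/andP[kl kp] p0] := (D_card, prime_gt0 p_prime).
have n0 : (0 < n)%N by rewrite subn_gt0 (leq_ltn_trans (leq_addr _ _) kl).
case; first by rewrite muln_gt0 p0.
  rewrite coprimeMr andbb coprime_sym prime_coprime // gtnNdvd //.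
  by apply: leq_ltn_trans kp; rewrite leq_subr.
set E := [set t * d | d in D]; have cE : #|E| = k by rewrite card_imset //; apply: mulfI.
rewrite [dilation _ _]dilate_set // => c hc.
pose M v := #|[set d in E | d - v \in D]|.
have Mc v : (M v)%:R = lam%:R + gr_fun c v *+ n.
  rewrite -gr_funMn -hc gr_funD gr_funN gr_funMn gr_setE in_setT gr_mul_bar_set.
  by rewrite addrC subrK.
(* If all p overlaps were at most lam, their sum k^2 would be at most lam p, against n > 0. *)
have [v Mv] : exists v, (lam < M v)%N.
  apply/existsP; apply: contraT; rewrite negb_exists => /forallP hM.
  suff : (k * k <= lam * p)%N by rewrite card_sqr; lia.
  have -> : (k * k = \sum_v M v)%N.
    rewrite -{1}cE; apply/eqP; rewrite -(eqr_nat int).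
    have := sum_gr_setM E [set -1 * d | d in D].
    rewrite -(dilate_set D (neg1_neq0 F)) -/(dilation (neg1_neq0 F)) -/(gr_bar _).
    rewrite [X in (_ * X)%N]card_imset => [<-|]; last by apply: mulfI; rewrite neg1_neq0.
    rewrite natr_sum; apply/eqP/eq_bigr => v _; exact: gr_mul_bar_set.
  have -> : (lam * p = \sum_(v : F) lam)%N by rewrite sum_nat_const card_Fp // mulnC.
  apply: leq_sum => v _.
  by have := hM v; rewrite -leqNgt.
have Mk : (k <= M v)%N.
  have [m km] : exists m, k = (lam + m)%N.
    by exists n; rewrite subnKC // ltnW // (leq_ltn_trans (leq_addr _ _) kl).
  have := Mc v; rewrite -mulr_natr /n km addKn !natz.
  move: (gr_fun c v) (M v) Mv => z u lu uE.
  have : (z <= 0) \/ (1 <= z) by lia.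
  clear -lu uE; case=> hz.
    by have : z * Posz m <= 0 by [rewrite mulr_le0_ge0]; lia.
  by have : Posz m <= z * Posz m by [rewrite ler_peMl]; lia.
exists v => d dD.
have : [set x in E | x - v \in D] == E.
  rewrite eqEcard cE; apply/andP; split=> //.
  by apply/subsetP => x; rewrite inE; case/andP.
move/eqP/setP/(_ (t * d)); rewrite inE.
by have -> : t * d \in E by [apply: imset_f].
Qed.

(** The element s / (t - 1) is the fixed point of the map d -> t d - s. With the origin moved there,
    D is stable under multiplication by t. *)
Lemma multiplier_translate t : t != 0 -> t != 1 -> t ^+ q = 1 ->
  exists c, forall d, d + c \in D -> t * d + c \in D.
Proof.
move=> t0 t1 /(multiplier t0)[s hs]; exists (s / (t - 1)) => d /hs.
set c := s / (t - 1); suff -> : t * (d + c) - s = t * d + c by [].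
have -> : s = (t - 1) * c by rewrite /c mulrC divfK // subr_eq0.
by rewrite mulrDr mulrBl mul1r -addrA subKr.
Qed.

End Multiplier.

(** * Counts of sums and differences, and their energies *)

Definition sum_count (V : finZmodType) (D : {set V}) (v : V) : nat :=
  #|[set d in D | v - d \in D]|.

(** The change of variables behind the symmetries of the counts: an injective self-map of a finite
    type is bijective. *)
Lemma card_sep_inj (T : finType) (D E : {set T}) (P Q : pred T) (f : T -> T) :
  injective f -> (forall x, (f x \in E) && Q (f x) = (x \in D) && P x) ->
  #|[set x in D | P x]| = #|[set x in E | Q x]|.
Proof.
move=> f_inj h; rewrite -(card_imset _ f_inj); apply: eq_card => y.
have [f' _ f'K] := injF_bij f_inj.
by rewrite -(f'K y) mem_imset // !inE h.
Qed.

Lemma diff_countN (V : finZmodType) (D : {set V}) v :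
  diff_count D (- v) = diff_count D v.
Proof.
by apply: (card_sep_inj (@addIr _ (- v))) => d; rewrite subrK andbC.
Qed.

(* Both sides are the coefficient of [0] in [D * D * bar (D * D)]. *)
Lemma sum_count_energy (F : finFieldType) (D : {set F}) :
  (\sum_v sum_count D v ^ 2 = \sum_v diff_count D v ^ 2)%N.
Proof.
pose x := gr_set D.
have e : x * x * gr_bar (x * x) = (x * gr_bar x) * gr_bar (x * gr_bar x).
  have bb : gr_bar (gr_bar x) = x.
    by rewrite [LHS]dilate_dilate mulrNN mulr1 dilate1.
  by rewrite /gr_bar !rmorphM /= -!/(gr_bar _) bb mulrACA [_ x * x]mulrC.
have h y : gr_fun (y * gr_bar y) 0 = \sum_v gr_fun y v ^+ 2.
  rewrite gr_funM; apply: eq_bigr => v _.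
  by rewrite dilateE invrN invr1 mulN1r sub0r opprK expr2.
have := congr1 (fun z => gr_fun z 0) e; rewrite /= !h => {e} e.
apply/eqP; rewrite -(eqr_nat int) !natr_sum; apply/eqP.
transitivity (\sum_v gr_fun (x * x) v ^+ 2).
  by apply: eq_bigr => v _; rewrite gr_setM natrX.
rewrite e (reindex_inj oppr_inj) /=; apply: eq_bigr => v _.
by rewrite gr_mul_bar_set natrX; congr (_%:R ^+ 2); apply: eq_card => d; rewrite !inE opprK.
Qed.

Lemma sum_sum_count (F : finFieldType) (D : {set F}) :
  (\sum_v sum_count D v = #|D| * #|D|)%N.
Proof.
apply/eqP; rewrite -(eqr_nat int) natr_sum -sum_gr_setM; apply/eqP.
by apply: eq_bigr => v _; rewrite gr_setM.
Qed.

Lemma sum_diff_count (F : finFieldType) (D : {set F}) :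
  (\sum_v diff_count D v = #|D| * #|D|)%N.
Proof.
have cN : #|[set -1 * d | d in D]| = #|D|.
  by apply: card_imset; apply: mulfI; apply: neg1_neq0.
apply/eqP; rewrite -(eqr_nat int) natr_sum -{2}cN.
rewrite -sum_gr_setM -(dilate_set D (neg1_neq0 F)) -/(dilation (neg1_neq0 F)).
rewrite -/(gr_bar _) [in X in _ == X](reindex_inj oppr_inj) /=; apply/eqP.
apply: eq_bigr => v _; rewrite gr_mul_bar_set; congr (_%:R).
by apply: eq_card => d; rewrite !inE opprK.
Qed.

(** * Sums and differences of quartic residues *)

Section QuarticResidues.

Variables (F : finFieldType) (q u : nat) (g : F).
Hypotheses (qE : q = u.*2.+1) (cardF : #|F| = (4 * q).+1).
Hypothesis g_prim : (4 * q).-primitive_root g.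

Let q_gt0 : (0 < q)%N. Proof. by rewrite qE. Qed.

Let g_neq0 : g != 0.
Proof. by rewrite (prim_root_eq0 g_prim) muln_eq0 -!lt0n q_gt0. Qed.

Lemma prim_powers_nonzero : [set g ^+ m | m : 'I_(4 * q)] = [set~ 0].
Proof.
apply/eqP; rewrite eqEcard cardsC1 cardF card_imset ?card_ord ?leqnn ?andbT.
  by apply/subsetP => x /imsetP[m _ ->]; rewrite !inE expf_neq0.
move=> m1 m2 /eqP; rewrite (eq_prim_root_expr g_prim) !modn_small //.
by move/eqP/val_inj.
Qed.

Lemma exp_shift (f : F -> nat) j i : (forall x, f (g ^+ 4 * x) = f x) ->
  f (g ^+ (4 * j + i)) = f (g ^+ i).
Proof. by move=> f4; elim: j => // j IHj; rewrite mulnS -addnA exprD f4. Qed.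

(** Invariance under g^4 makes f constant on the four cosets of the quartic residues, each of size
    q. *)
Lemma sum_quartic (f : F -> nat) : (forall x, f (g ^+ 4 * x) = f x) ->
  (\sum_x f x = f 0%R + q * (f 1%R + f g + f (g ^+ 2)%R + f (g ^+ 3)%R))%N.
Proof.
move=> f4; rewrite (bigD1 0) //=; congr (_ + _)%N.
transitivity (\sum_(m < 4 * q) f (g ^+ m)%R)%N.
  transitivity (\sum_(x in [set~ 0%R]) f x)%N.
    by apply: eq_bigl => x; rewrite !inE.
  rewrite -prim_powers_nonzero big_imset // => m1 m2 _ _ /eqP.
  rewrite (eq_prim_root_expr g_prim) !modn_small //.
  by move/eqP/val_inj.
elim: (q) => [|m IH]; first by rewrite muln0 big_ord0.
rewrite mulnS !addSn add0n !big_ord_recr /= IH.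
have f0 := exp_shift m 0 f4; have f1 := exp_shift m 1 f4.
have f2 := exp_shift m 2 f4; have f3 := exp_shift m 3 f4.
rewrite addn0 in f0; rewrite addn1 in f1; rewrite addn2 in f2; rewrite addn3 in f3.
rewrite f0 f1 f2 f3 expr0 expr1; ring.
Qed.

Lemma prim_neg1 : -1 = g ^+ (2 * q).
Proof.
have := prim_expr_order g_prim; rewrite (_ : (4 * q = 2 * q * 2)%N); last by ring.
rewrite exprM => /eqP; rewrite sqrf_eq1 => /orP[/eqP e|/eqP ->] //.
have := prim_order_dvd g_prim (2 * q); rewrite e eqxx => /dvdn_leq.
by rewrite muln_gt0 q_gt0 leq_mul2r => /(_ isT); case: (q) q_gt0.
Qed.

(** These are the nonzero fourth powers, since the group of units is cyclic of order 4 q. *)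
Let H := [set x : F | x ^+ q == 1].

Lemma quartic_expr j : (g ^+ j \in H) = (4 %| j)%N.
Proof.
rewrite inE -exprM -(prim_order_dvd g_prim) [(j * q)%N]mulnC [(4 * q)%N]mulnC.
by rewrite dvdn_pmul2l.
Qed.

Lemma quartic_mull x y : x \in H -> (x * y \in H) = (y \in H).
Proof. by rewrite !inE exprMn => /eqP ->; rewrite mul1r. Qed.

Lemma quartic_inv x : (x^-1 \in H) = (x \in H).
Proof. by rewrite !inE exprVn invr_eq1. Qed.

Lemma quartic_neq0 x : x \in H -> x != 0.
Proof.
by rewrite inE; apply: contraTneq => ->; rewrite expr0n eqn0Ngt q_gt0 eq_sym oner_eq0.
Qed.

Let g4H : g ^+ 4 \in H. Proof. by rewrite quartic_expr. Qed.

Lemma diff_count4 x : diff_count H (g ^+ 4 * x) = diff_count H x.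
Proof.
symmetry; apply: (card_sep_inj (mulfI (expf_neq0 4 g_neq0))) => d.
by rewrite -mulrDr !(quartic_mull _ g4H).
Qed.

Lemma sum_count4 x : sum_count H (g ^+ 4 * x) = sum_count H x.
Proof.
symmetry; apply: (card_sep_inj (mulfI (expf_neq0 4 g_neq0))) => d.
by rewrite -mulrBr !(quartic_mull _ g4H).
Qed.

Lemma quartic0F : (0 \in H) = false.
Proof. by apply/negP => /quartic_neq0; rewrite eqxx. Qed.

Lemma card_quartic : #|H| = q.
Proof.
have f4 x : nat_of_bool (g ^+ 4 * x \in H) = (x \in H) by rewrite (quartic_mull _ g4H).
rewrite -sum1_card big_mkcond /=.
transitivity (\sum_x nat_of_bool (x \in H))%N.
  by apply: eq_bigr => x _; case: (x \in H).
have gH : (g \in H) = false by rewrite -(expr1 g) quartic_expr.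
by rewrite (sum_quartic f4) gH -(expr0 g) !quartic_expr quartic0F muln1.
Qed.

(** As q is odd, -1 = g^(2 q) with 2 q = 4 u + 2, so negation moves the quartic class by two. *)
Lemma neg_exp j : - g ^+ j = g ^+ (4 * u + (2 + j)).
Proof.
rewrite -mulN1r prim_neg1 -exprD; congr (_ ^+ _).
by rewrite qE -addnn; ring.
Qed.

Lemma diff_count_exp2 j : diff_count H (g ^+ (2 + j)) = diff_count H (g ^+ j).
Proof. by rewrite -(exp_shift u _ diff_count4) -neg_exp diff_countN. Qed.

Lemma sum_count_neg j : sum_count H (- g ^+ j) = sum_count H (g ^+ (2 + j)).
Proof. by rewrite neg_exp (exp_shift _ _ sum_count4). Qed.

Lemma quartic_oppF x : x \in H -> (- x \in H) = false.
Proof.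
move=> xH; rewrite -mulrN1 quartic_mull // prim_neg1 quartic_expr qE -addnn.
by apply/negP; lia.
Qed.

Lemma sum_count0 : sum_count H 0 = 0%N.
Proof.
apply: eq_card0 => x; apply/negP; rewrite inE => /andP[xH].
by rewrite sub0r quartic_oppF.
Qed.

(** Inversion works: x^-1 - 1 = x^-1 (1 - x), so for x in H the element 1 - x lies in H exactly when
    x^-1 - 1 does. *)
Lemma sum_count1 : sum_count H 1 = diff_count H 1.
Proof.
rewrite -diff_countN; apply: (card_sep_inj (@invr_inj F)) => x.
rewrite quartic_inv; apply: andb_id2l => xH.
have -> : x^-1 + -1 = x^-1 * (1 - x) by rewrite mulrBr mulr1 mulVf // quartic_neq0.
by rewrite quartic_mull // quartic_inv.
Qed.

Lemma quartic_opp x : (- x \in H) = (x * g ^+ 2 \in H).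
Proof.
have h : g ^+ (4 * u) \in H by rewrite quartic_expr dvdn_mulr.
rewrite -mulrN1 -[-1]/(- 1) -(expr0 g) neg_exp addn0 exprD mulrCA.
by rewrite (quartic_mull _ h).
Qed.

Lemma sum_quartic_classes x : x != 0 ->
  ((x \in H) + (x * g \in H)%R + (x * g ^+ 2 \in H)%R + (x * g ^+ 3 \in H)%R = 1)%N.
Proof.
move=> x0; have : x \in [set~ 0] by rewrite !inE.
rewrite -prim_powers_nonzero => /imsetP[m _ ->].
rewrite -exprSr -(addn1 m) -!exprD !quartic_expr.
rewrite /dvdn -(modnDml m 1) -(modnDml m 2) -(modnDml m 3).
by case: (m %% 4)%N (ltn_pmod m (isT : 0 < 4)%N) => [|[|[|[|]]]].
Qed.

Lemma card_sep_sum (T : finType) (D : {set T}) (P : pred T) :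
  #|[set x in D | P x]| = (\sum_(x in D) P x)%N.
Proof.
rewrite -sum1_card [RHS]big_mkcond [LHS]big_mkcond; apply: eq_bigr => x _.
by rewrite inE; case: (x \in D); case: (P x).
Qed.

(* The four counts sort the nonzero elements [1 + g * h], for [h \in H], by
   their class modulo [H]. *)
Lemma quartic_class_counts :
  (diff_count H g + sum_count H g + sum_count H (g ^+ 3)%R + diff_count H g)%N = q.
Proof.
have e0 : diff_count H g = #|[set h in H | 1 + g * h \in H]|.
  apply: (card_sep_inj (@invr_inj F)) => h; rewrite quartic_inv; apply: andb_id2l => hH.
  have -> : 1 + g * h^-1 = h^-1 * (h + g).
    by rewrite mulrDr mulVf ?quartic_neq0 // mulrC.
  by rewrite quartic_mull // quartic_inv.
have e1 : sum_count H g = #|[set h in H | (1 + g * h) * g \in H]|.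
  have -> : sum_count H g = sum_count H (- g ^+ 3).
    by rewrite sum_count_neg -[in LHS](expr1 g) (exp_shift 1 1 sum_count4).
  symmetry; apply: (card_sep_inj (mulfI (expf_neq0 4 g_neq0))) => h.
  rewrite (quartic_mull _ g4H); congr (_ && _); rewrite -opprD quartic_opp.
  by rewrite -[RHS](quartic_mull _ g4H); congr (_ \in H); ring.
have e2 : sum_count H (g ^+ 3) = #|[set h in H | (1 + g * h) * g ^+ 2 \in H]|.
  rewrite -(sum_count_neg 1) expr1.
  symmetry; apply: (card_sep_inj (@invr_inj F)) => h.
  rewrite quartic_inv; apply: andb_id2l => hH; rewrite -opprD quartic_opp.
  have -> : (g + h^-1) * g ^+ 2 = h^-1 * ((1 + g * h) * g ^+ 2).
    rewrite [RHS]mulrA; congr (_ * _).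
    by rewrite mulrDr mulr1 mulrCA mulVf ?quartic_neq0 // mulr1 addrC.
  by rewrite quartic_mull // quartic_inv.
have e3 : diff_count H g = #|[set h in H | (1 + g * h) * g ^+ 3 \in H]|.
  have := diff_count_exp2 1; rewrite expr1 => <-.
  symmetry; apply: (card_sep_inj (mulfI (expf_neq0 4 g_neq0))) => h.
  by rewrite (quartic_mull _ g4H); congr (_ && (_ \in H)); ring.
rewrite {1}e0 e1 e2 e3 !card_sep_sum -!big_split /= -[RHS]card_quartic -sum1_card.
apply: eq_bigr => h hH; apply: sum_quartic_classes; rewrite addr_eq0.
(* The sum 1 + g h never vanishes: -1 lies in the class of g^2, while g h lies in that of g. *)
apply/eqP => e; have : 1 \in H by rewrite -(expr0 g) quartic_expr.
rewrite e quartic_opp -mulrA mulrCA (quartic_mull _ hH) -exprS quartic_expr.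
by [].
Qed.

(** Write s1 and s2 for the sum counts at g and g^3. The totals of sums and of differences, the
    class count of 1 + g H and the equality of energies determine s1 + s2 and s1^2 + s2^2 from a and
    b, hence (s1 - s2)^2. *)
Lemma quartic_corr_square (z := (sum_count H g)%:Z - (sum_count H (g ^+ 3))%:Z)
    (a := (diff_count H 1)%:Z) (b := (diff_count H g)%:Z) :
  q%:Z = 1 + 2 * a + 2 * b /\ z ^+ 2 = 4 * b + 1 - 4 * (a - b) ^+ 2.
Proof.
have E1 := sum_sum_count H; have E2 := sum_diff_count H.
have E4 := sum_count_energy H.
have d0 : diff_count H 0 = q.
  by rewrite -[RHS]card_quartic; apply: eq_card => d; rewrite [LHS]in_set addr0 andbb.
have d2 : diff_count H (g ^+ 2) = diff_count H 1.
  by rewrite -(diff_count_exp2 0).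
have d3 : diff_count H (g ^+ 3) = diff_count H g.
  by have := diff_count_exp2 1; rewrite expr1.
have sq (f : F -> nat) : (forall x, f (g ^+ 4 * x) = f x) ->
    forall x, (f (g ^+ 4 * x)%R ^ 2 = f x ^ 2)%N.
  by move=> f4 x; rewrite f4.
rewrite card_quartic (sum_quartic sum_count4) sum_count0 sum_count1 in E1.
rewrite card_quartic (sum_quartic diff_count4) d0 d2 d3 in E2.
rewrite (sum_quartic (sq _ sum_count4)) (sum_quartic (sq _ diff_count4)) in E4.
rewrite sum_count0 sum_count1 d0 d2 d3 in E4.
have E3 := quartic_class_counts.
rewrite /z /a /b; move: E1 E2 E3 E4 q_gt0.
move: (sum_count H (g ^+ 3)) (sum_count H (g ^+ 2)).
move: (diff_count H 1) (diff_count H g) (sum_count H g).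
move=> x y s1 s2 s3 E1 E2 E3 E4 q0.
(* The totals and the energies share a common factor q, which is cancelled here and in the next two
   relations. *)
have {}E1 : (q = x + s1 + s2 + s3)%N.
  by apply/eqP; rewrite -(eqn_pmul2l q0); apply/eqP; rewrite -E1; ring.
have {}E2 : (q = 1 + x + y + x + y)%N.
  by apply/eqP; rewrite -(eqn_pmul2l q0); apply/eqP; rewrite -E2; ring.
have {}E4 : (x ^ 2 + s1 ^ 2 + s3 ^ 2 + s2 ^ 2 = q + x ^ 2 + y ^ 2 + x ^ 2 + y ^ 2)%N.
  by apply/eqP; rewrite -(eqn_pmul2l q0); apply/eqP; apply: (etrans _ (etrans E4 _)); ring.
split; first lia.
have -> : (s1%:Z - s2%:Z) ^+ 2
    = 2 * (s1%:Z ^+ 2 + s2%:Z ^+ 2) - (s1%:Z + s2%:Z) ^+ 2 by ring.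
have -> : s1%:Z + s2%:Z = 2 * x%:Z + 1 by lia.
have -> : s1%:Z ^+ 2 + s2%:Z ^+ 2
    = 1 + 2 * x%:Z + 2 * y%:Z + x%:Z ^+ 2 + 2 * y%:Z ^+ 2 - s3%:Z ^+ 2 by lia.
have -> : s3%:Z = 2 * y%:Z - x%:Z by lia.
by ring.
Qed.

End QuarticResidues.

(** * Excluding H and {0} + H as difference sets *)

Lemma finField_prim_root (F : finFieldType) :
  exists g : F, #|F|.-1.-primitive_root g.
Proof.
have F1 := finNzRing_gt1 F.
have : has #|F|.-1.-primitive_root (enum [set~ (0 : F)]).
  apply: has_prim_root; rewrite ?enum_uniq -?cardE ?cardsC1 //.
    by rewrite -subn1 subn_gt0.
  apply/allP => x; rewrite mem_enum !inE => x0.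
  by apply/unity_rootP/expf_card_pred.
by case/hasP => g _; exists g.
Qed.

Lemma diff_count_preimset (V : finZmodType) (D : {set V}) (f : V -> V) (v w : V) :
  injective f -> (forall d, f (d + v) = f d + w) ->
  diff_count (f @^-1: D) v = diff_count D w.
Proof.
move=> f_inj fD; apply: (card_sep_inj f_inj) => d.
by rewrite !inE fD.
Qed.

(** Inclusion-exclusion for D and its translate by -v. The complement of a difference set is
    therefore again one. *)
Lemma diff_countC (V : finZmodType) (D : {set V}) v :
  (diff_count (~: D) v + (#|D| + #|D|) = #|V| + diff_count D v)%N.
Proof.
pose E := [set d | d + v \in D].
have cE : #|E| = #|D|.
  exact: (card_preimset D (@addIr _ v)).
have -> : diff_count (~: D) v = #|~: (D :|: E)|.
  by apply: eq_card => d; rewrite !inE negb_or.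
have -> : diff_count D v = #|D :&: E| by apply: eq_card => d; rewrite !inE.
by rewrite -{2}cE -cardsUI addnA [(#|~: _| + _)%N]addnC cardsC.
Qed.

Lemma prime_neq_sqr (q : nat) (z : int) : prime q -> z ^+ 2 != q%:Z.
Proof.
move=> pq; apply/eqP => zq; have {zq} : (`|z| * `|z| = q)%N by lia.
move=> e; have : (`|z| %| q)%N by rewrite -e dvdn_mulr.
case/primeP: pq => q1 h /h /orP[] /eqP ez; move: e q1; rewrite ez; nia.
Qed.

(** Let q = m^2 + 2. If 3 divides m, then 3 divides 4 q + 1; otherwise m^2 is 1 modulo 3, and 3
    divides q. *)
Lemma prime_sqr_plus2 (q : nat) (z : int) :
  prime q -> (3 < q)%N -> prime (4 * q + 1) -> z ^+ 2 != q%:Z - 2.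
Proof.
move=> pq q3 pp; apply/eqP => zq.
have {zq} [m mq] : exists m : nat, q = (m * m + 2)%N by exists `|z|%N; lia.
have [d3|d3] := boolP (3 %| m)%N.
  have : (3 %| 4 * q + 1)%N.
    case/dvdnP: d3 => c mc; apply/dvdnP; exists (12 * c * c + 3)%N.
    by rewrite mq mc; ring.
  by rewrite (dvdn_prime2 _ pp) // => /eqP; lia.
have [c mc] : exists c, (m = 3 * c + 1 \/ m = 3 * c + 2)%N.
  by exists (m %/ 3)%N; move: d3; lia.
have : (3 %| q)%N.
  apply/dvdnP; rewrite mq; case: mc => ->.
    by exists (3 * c * c + 2 * c + 1)%N; ring.
  by exists (3 * c * c + 4 * c + 2)%N; ring.
by rewrite (dvdn_prime2 _ pq) // => /eqP; lia.
Qed.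

Lemma difference_set_count (V : finFieldType) (D : {set V}) (lam : nat) :
  (forall v, v != 0 -> diff_count D v = lam) ->
  (#|D| + #|V|.-1 * lam = #|D| * #|D|)%N.
Proof.
move=> D_diff; have d0 : diff_count D 0 = #|D|.
  by apply: eq_card => d; rewrite inE addr0 andbb.
rewrite -sum_diff_count (bigD1 0) //= d0; congr (_ + _)%N.
have -> : #|V|.-1 = #|predC1 (0 : V)| by rewrite cardC1.
by rewrite -sum_nat_const; apply: eq_bigr => v /D_diff.
Qed.

Lemma stable_quartic_coset (F : finFieldType) (q : nat) (g : F) (D : {set F}) :
  (0 < q)%N -> (4 * q).-primitive_root g -> #|F| = (4 * q).+1 ->
  (forall d, d \in D -> g ^+ 4 * d \in D) -> 1 \in D ->
  [set x : F | x ^+ q == 1] \subset D.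
Proof.
move=> q0 g_prim cF D4 D1; apply/subsetP => x; rewrite inE => /eqP xq.
have g4 : q.-primitive_root (g ^+ 4).
  have := dvdn_prim_root g_prim (dvdn_mull 4 (dvdnn q)).
  by rewrite mulnK.
have [i ->] := prim_rootP g4 xq.
elim: (nat_of_ord i) => [|j IH]; first by rewrite expr0.
by rewrite exprS; apply: D4.
Qed.

(** Here a = b, so q = 4 b + 1 and the square in [quartic_corr_square] is q itself. *)
Lemma quartic_no_difference_set (F : finFieldType) (q u : nat) (g : F) (lam : nat)
    (H := [set x : F | x ^+ q == 1]) :
  q = u.*2.+1 -> #|F| = (4 * q).+1 -> (4 * q).-primitive_root g ->
  prime q -> ~ (forall v, v != 0 -> diff_count H v = lam).
Proof.
move=> qE cF g_prim pq h.
have [] := quartic_corr_square qE cF g_prim; rewrite -/H.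
have g0 : g != 0 by rewrite (prim_root_eq0 g_prim) qE.
rewrite !h ?oner_eq0 // => e1; rewrite subrr => e2.
by have /eqP[] := @prime_neq_sqr q ((sum_count H g)%:Z - (sum_count H (g ^+ 3))%:Z) pq; lia.
Qed.

(** Adjoining 0 raises the count at 1 by one and leaves the count at g unchanged. Hence b = a + 1, q
    = 4 b - 1, and the square in [quartic_corr_square] is q - 2. *)
Lemma quartic0_no_difference_set (F : finFieldType) (q u : nat) (g : F) (lam : nat)
    (H := [set x : F | x ^+ q == 1]) :
  q = u.*2.+1 -> #|F| = (4 * q).+1 -> (4 * q).-primitive_root g ->
  prime q -> (3 < q)%N -> prime (4 * q + 1) ->
  ~ (forall v, v != 0 -> diff_count (0 |: H) v = lam).
Proof.
move=> qE cF g_prim pq q3 pp h.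
have [] := quartic_corr_square qE cF g_prim; rewrite -/H.
have q0 := prime_gt0 pq.
have g0 : g != 0 by rewrite (prim_root_eq0 g_prim) qE.
have zH : 0 \notin H by apply/negP => /(quartic_neq0 qE); rewrite eqxx.
pose E := 0 |: H.
have hd v : v != 0 -> diff_count E v
    = (diff_count H v + (v \in H) + (- v \in H)%R)%N.
  move=> v0; rewrite /diff_count !card_sep_sum /E big_setU1 //= add0r.
  rewrite in_setU1 (negbTE v0) addnAC [RHS]addnC; congr (_ + _)%N.
  transitivity (\sum_(d in H) (((d + v)%R \in H) + (d == - v)%R))%N.
    apply: eq_bigr => d _; rewrite in_setU1 addr_eq0.
    by have [->|] := eqVneq d (- v); rewrite ?addNr ?(negbTE zH) ?addn0.
  rewrite big_split /=; congr (_ + _)%N.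
  have [vH|vH] := boolP (- v \in H).
    rewrite (bigD1 (- v)) //= eqxx big1 ?addn0 // => d /andP[_ /negbTE ->].
    by [].
  rewrite big1 // => d dH; case: eqVneq => // e.
  by rewrite -e dH in vH.
have h1 := h 1 (oner_neq0 F); rewrite hd ?oner_neq0 // in h1.
have hg := h g g0; rewrite hd // in hg.
have i1 : 1 \in H by rewrite -(expr0 g) (quartic_expr qE g_prim).
have ig : g \notin H by rewrite -(expr1 g) (quartic_expr qE g_prim).
have ing : - g \notin H.
  rewrite -(expr1 g) (neg_exp qE g_prim) (quartic_expr qE g_prim).
  by rewrite /dvdn mulnC modnMDl.
rewrite i1 (quartic_oppF qE cF g_prim i1) in h1.
rewrite (negbTE ig) (negbTE ing) in hg.
move: h1 hg; rewrite !addn0 => <- ->.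
move=> e1 e2.
have /eqP[] := @prime_sqr_plus2 q ((sum_count H g)%:Z - (sum_count H (g ^+ 3))%:Z) pq q3 pp.
rewrite e2; lia.
Qed.

(** * The case p = 4 q + 1 *)

(** From k (k - 1) = 4 lam q the prime q divides k or k - 1. The value k = 2 q would give k - 1 = 2
    lam, impossible by parity. *)
Lemma small_difference_set_params (q k lam : nat) : prime q -> (3 < q)%N ->
  (k + 4 * q * lam = k * k)%N -> (2 <= k <= 2 * q)%N ->
  (k = q \/ k = q.+1) /\ (lam + lam < k)%N.
Proof.
move=> pq q3 e /andP[k2 kq].
have ek : (k * k.-1 = 4 * lam * q)%N.
  by case: k k2 e {kq} => // k _ e; move: e => /=; nia.
have q0 := prime_gt0 pq.
have cancel m n : (m * q = n * q)%N -> m = n.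
  by move=> /eqP; rewrite eqn_pmul2r // => /eqP.
have : (q %| k * k.-1)%N by rewrite ek dvdn_mull.
rewrite Euclid_dvdM // => /orP[] /dvdnP[c kc].
  have c2 : (c <= 2)%N by rewrite -(leq_pmul2r q0) -kc.
  have {}ek : (c * k.-1 = 4 * lam)%N by apply: cancel; rewrite -ek kc; ring.
  case: c kc c2 ek => [|[|[|c]]] // kc _; rewrite ?mul1n in kc *; lia.
have c1 : (c = 1)%N.
  have c2 : (c < 2)%N by rewrite -(ltn_pmul2r q0) -kc; lia.
  by case: c kc c2 => [|[|c]] //; lia.
have {}ek : (k * c = 4 * lam)%N by apply: cancel; rewrite -ek kc; ring.
by move: kc ek; rewrite c1; lia.
Qed.

Section PrimeField.

Variables (p q : nat).
Hypotheses (p_prime : prime p) (q_prime : prime q) (q_gt3 : (3 < q)%N).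
Hypothesis pE : p = (4 * q).+1.

Local Notation F := 'F_p.

Lemma no_small_difference_set (D : {set F}) (lam : nat) :
  (forall v, v != 0 -> diff_count D v = lam) -> ~ (2 <= #|D| <= 2 * q)%N.
Proof.
move=> D_diff Dk; have q0 := prime_gt0 q_prime.
have cF : #|F| = (4 * q).+1 by rewrite card_Fp.
have [u qE] : exists u, q = u.*2.+1.
  exists q./2; rewrite -[LHS]odd_double_half; case: (even_prime q_prime) => [e|->] //.
  by have := q_gt3; rewrite e.
have [g] := finField_prim_root F; rewrite cF /= => g_prim.
have g0 : g != 0 by rewrite (prim_root_eq0 g_prim) muln_eq0 -!lt0n q0.
have := difference_set_count D_diff; rewrite cF /= => e.
have [kq laml] := small_difference_set_params q_prime q_gt3 e Dk.
have t0 : g ^+ 4 != 0 by rewrite expf_neq0.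
have t1 : g ^+ 4 != 1.
  by rewrite -(prim_order_dvd g_prim); apply/negP => /dvdn_leq => /(_ isT); lia.
have tq : (g ^+ 4) ^+ q = 1 by rewrite -exprM prim_expr_order.
have kp : (lam + lam < #|D| < p)%N.
  rewrite laml /=; case/andP: Dk => _ kq'; apply: leq_ltn_trans kq' _.
  by clear -pE q0; lia.
have [c hc] := multiplier_translate p_prime q_prime pE D_diff kp t0 t1 tq.
(* D has at least two points, so one of them differs from the centre c. Scaling by a makes it the
   point 1 of E, so that E contains the whole orbit H. *)
have [a a0 aD] : exists2 a, a != 0 & a + c \in D.
  have : (0 < #|D :\ c|)%N.
    case/andP: Dk => k2 _; rewrite -(ltn_add2l (c \in D)) -cardsD1 addn0.
    exact: leq_ltn_trans (leq_b1 _) k2.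
  case/card_gt0P => x; rewrite !inE => /andP[xc xD].
  by exists (x - c); rewrite ?subrK // subr_eq0.
pose f (d : F) := a * d + c.
have f_inj : injective f by move=> x y /addIr /(mulfI a0).
pose E := f @^-1: D.
have E_diff v : v != 0 -> diff_count E v = lam.
  move=> v0; rewrite (@diff_count_preimset _ D f v (a * v)) //.
    by apply: D_diff; rewrite mulf_neq0.
  by move=> d; rewrite /f mulrDr addrAC.
have cE : #|E| = #|D| by exact: card_preimset.
have E4 d : d \in E -> g ^+ 4 * d \in E.
  by rewrite !inE /f mulrCA => /hc.
have E1 : 1 \in E by rewrite inE /f mulr1.
pose H := [set x : F | x ^+ q == 1].
have HE := stable_quartic_coset q0 g_prim cF E4 E1.
have cH : #|H| = q := card_quartic qE cF g_prim.
case: kq => kq.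
  have EH : E = H.
    by apply/esym/eqP; rewrite eqEcard HE cH cE kq /=.
  by rewrite EH in E_diff; apply: (quartic_no_difference_set qE cF g_prim q_prime E_diff).
have EH : E = (0 : F) |: H.
  have : (0 < #|E :\: H|)%N.
    by rewrite cardsD (setIidPr HE) cH cE kq subSnn.
  case/card_gt0P => b; rewrite in_setD => /andP[bH bE].
  have Eb : E = b |: H.
    apply/esym/eqP; rewrite eqEcard subUset sub1set bE HE /=.
    by rewrite cardsU1 bH cH cE kq.
  (* Multiplication by g^4 keeps b in E and outside H, so it fixes the only point b of E outside H.
     As g^4 is not 1, b = 0. *)
  have := E4 b bE; rewrite {1}Eb in_setU1 => /orP[/eqP tb|].
    suff b0 : b = 0 by rewrite Eb b0.
    apply/eqP; apply: contraNT t1 => b0; apply/eqP/(mulIf b0).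
    by rewrite mul1r.
  by rewrite (quartic_mull _) ?(negbTE bH) // inE tq.
rewrite EH in E_diff.
apply: (quartic0_no_difference_set qE cF g_prim q_prime q_gt3 _ E_diff).
by rewrite addn1 -pE.
Qed.

Lemma no_difference_set (D : {set F}) (lam : nat) :
  (forall v, v != 0 -> diff_count D v = lam) ->
  ~ (2 <= #|D| /\ #|D| + 2 <= p)%N.
Proof.
move=> D_diff [k2 kp].
have [kq|kq] := leqP #|D| (2 * q).
  by apply: (no_small_difference_set D_diff); rewrite k2.
have cC : (#|~: D| + #|D| = p)%N by rewrite addnC cardsC card_Fp.
(* For k > 2 q the complement is used; its parameter p + lam - 2 k comes from [diff_countC], so the
   truncated subtraction is exact. *)
apply: (@no_small_difference_set (~: D) (p + lam - (#|D| + #|D|))).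
  by move=> v /D_diff e; have := diff_countC D v; rewrite card_Fp // e => <-; rewrite addnK.
move: #|~: D| #|D| cC kp kq => m k; have := pE; clear; lia.
Qed.

End PrimeField.

(** * Transfer to the prime field, Fermat primes, and the conclusion *)

Lemma cyclic_difference_set_transfer (p : nat) (gT : finGroupType)
    (G : {group gT}) (D : {set gT}) : prime p -> cyclic G -> #|G| = p ->
  is_difference_set G D ->
  exists (E : {set 'F_p}) (lam : nat),
    #|E| = #|D| /\ forall v, v != 0 -> diff_count E v = lam.
Proof.
move=> pp /cyclicP[x Gx] oG [DG [lam hlam]].
have ox : #[x]%g = p by rewrite orderE -Gx.
have xmod i : (x ^+ (i %% p) = x ^+ i)%g by rewrite -ox expg_mod_order.
pose f (v : 'F_p) := (x ^+ val v)%g.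
(* The elements of ['F_p] are ordinals below this expression, which is p because p is prime. *)
have Fp : (Zp_trunc (pdiv p)).+2 = p by apply: Fp_cast.
have vp (v : 'F_p) : (val v < p)%N by rewrite -[X in (_ < X)%N]Fp; apply: ltn_ord.
have fD u v : f (u + v) = (f u * f v)%g.
  rewrite /f.
  have -> : val (u + v) = ((val u + val v) %% p)%N.
    transitivity ((val u + val v) %% (Zp_trunc (pdiv p)).+2)%N => //.
    by congr (_ %% _)%N.
  by rewrite xmod expgD.
have f_inj : injective f.
  move=> u v /eqP; rewrite eq_expg_mod_order ox !modn_small //.
  by move/eqP/val_inj.
have fG v : f v \in G by rewrite Gx mem_cycle.
have f1 v : v != 0 -> f v != 1%g.
  by apply: contraNneq => e; apply/eqP/f_inj; rewrite e /f expg0.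
have f_surj y : y \in G -> exists v, y = f v.
  rewrite Gx => /cycleP[i ->]; exists (inord (i %% p)).
  rewrite /f /= inordK; last by rewrite Fp ltn_mod prime_gt0.
  by rewrite xmod.
exists (f @^-1: D), lam; split.
  rewrite -(card_imset _ f_inj); apply: eq_card => y.
  apply/imsetP/idP => [[v]|yD]; first by rewrite inE => h ->.
  have [v e] := f_surj y (subsetP DG y yD).
  by exists v => //; rewrite inE -e.
move=> v v0; rewrite -(hlam (f v)) ?f1 //.
(* Pairs in D with quotient [f v] are parametrized by the exponent d of their first entry, the
   second being [f (d + v)]. *)
have pair_inj : injective (fun d => (f d, f (d + v))) by move=> d e [/f_inj].
rewrite /diff_count -(card_imset _ pair_inj); apply: eq_card => -[y z].
apply/imsetP/idP => [[d]|]; rewrite !inE /=.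
  by case/andP=> h1 h2 [-> ->]; rewrite h1 h2 fD mulKg eqxx.
case/and3P => yD zD /eqP e.
have [d ye] := f_surj y (subsetP DG y yD).
have ze : z = f (d + v) by rewrite fD e -ye mulKVg.
by exists d; rewrite ?inE -?ye -?ze ?yD ?zD.
Qed.

(** Exactly one of k and k - 1 is even, so 2^m would divide it; but both lie strictly between 0 and
    2^m. *)
Lemma no_difference_set_pow2 (p m k lam : nat) : p = (2 ^ m + 1)%N ->
  (k + p.-1 * lam = k * k)%N -> ~ (2 <= k /\ k + 2 <= p)%N.
Proof.
move=> -> ; rewrite addn1 /= => e [k2 kp].
have ek : (k * k.-1 = 2 ^ m * lam)%N.
  by case: k k2 e {kp} => // k _ e; move: e => /=; nia.
have h : (2 ^ m %| k * k.-1)%N by rewrite ek dvdn_mulr.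
have [o|o] := boolP (odd k).
  rewrite Gauss_dvdr in h; last by rewrite coprimeXl // coprime2n.
  by have := dvdn_leq _ h; lia.
rewrite Gauss_dvdl in h; last first.
  by rewrite coprimeXl // coprime2n; move: o k2; case: (k) => //= n; rewrite negbK.
by have := dvdn_leq _ h; lia.
Qed.

Local Close Scope ring_scope.

Theorem theorem1p4 (p : nat) (p_prime : prime p)
    (hp : fermat_prime p \/
          exists q : nat, [/\ prime q, 3 < q & p = 4 * q + 1])
    (gT : finGroupType) (G : {group gT}) (cycG : cyclic G) (oG : #|G| = p) :
  ~ exists D : {set gT}, nontrivial_difference_set G D.
Proof.
case=> D [D_diff D2]; rewrite oG => Dp.
have [E [lam [cE E_diff]]] := cyclic_difference_set_transfer p_prime cycG oG D_diff.
rewrite -cE in D2 Dp; case: hp => [[_ [m _ pE]]|[q [pq q3 pE]]].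
  have := difference_set_count E_diff; rewrite card_Fp // => e.
  exact: (no_difference_set_pow2 pE e).
by apply: (no_difference_set p_prime pq q3 _ E_diff); rewrite ?addn1 // pE addn1.
Qed.
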